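(* Let $p\ge3$ be prime, $d,R\in\mathbb{Q}$, $d\ne0$, $R$ not a square, $D=d^2-R$. If $f_p=f_p(Z,d,R)$ has no zero in $\mathbb{Q}$, then $f_p$ is irreducible in $\mathbb{Q}[Z]$.
   Context: $f_p(Z,d,R)=\sum_{j=0}^{(p-1)/2}(-1)^j\frac{p}{p-j}\binom{p-j}{j}D^jZ^{p-2j}-2dD^{(p-1)/2}$, which equals $\sqrt D^{\,p}F_p(Z/\sqrt D)-2dD^{(p-1)/2}$ where $F_p(Z)=2T_p(Z/2)$ and $T_p$ is the Chebyshev polynomial of the first kind. *)

(* Defs.v *)
From mathcomp Require Import all_boot all_order all_algebra.
Set Implicit Arguments. Unset Strict Implicit. Unset Printing Implicit Defensive.
Import Order.TTheory GRing.Theory Num.Theory.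
Local Open Scope ring_scope.

Definition f_poly (p : nat) (d R : rat) : {poly rat} :=
  let D := d ^+ 2 - R in
  \sum_(0 <= j < (p.-1)./2 + 1)
     ((-1) ^+ j * (p%:R / (p - j)%:R) * ('C(p - j, j))%:R * D ^+ j) *: 'X^(p - 2 * j)
  - (2 * d * D ^+ ((p.-1)./2))%:P.

(* Main.v *)
(* Put D = d^2 - R, K = Q(sqrt R), h = (p - 1)/2 and a = D^h (d + sqrt R), so
   that a times its conjugate a' is D^p.  Waring's formula gives
   f_p(x + y) = x^p + y^p - (a + a') whenever x y = D, so z = al + D/al is a root
   of f_p when al^p = a.
   If al has degree < p over K, the constant coefficient of its minimal
   polynomial yields b in K with b^p = a; then the norm of b is D (its p-th power
   is D^p and p is odd) and the trace of b is a rational root of f_p.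
   Otherwise p divides the degree of Q(z, al, sqrt R), which is obtained from
   Q(z) by adjoining two elements of degree at most 2; so p divides [Q(z) : Q],
   and every nonzero rational polynomial vanishing at z has degree at least p. *)
Require Import Defs.
From mathcomp Require Import all_boot all_order all_algebra all_field.
From mathcomp Require Import ring zify.
Import Order.TTheory GRing.Theory Num.Theory.
Local Open Scope ring_scope.
Set Implicit Arguments.
Unset Strict Implicit.

(* The upper bound m is free because 'C(n - j, j) = 0 for 2 j > n; there the
   truncated exponent n - 2 j is a junk value. *)
Lemma sum_bin_exprD (A : comNzRingType) (x y : A) (n m : nat) :
  (n./2 < m)%N ->
  \sum_(j < m) ((- (x * y)) ^+ j * (x + y) ^+ (n - 2 * j)) *+ 'C(n - j, j)
    = \sum_(i < n.+1) x ^+ (n - i) * y ^+ i.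
Proof.
pose t n j : A := ((- (x * y)) ^+ j * (x + y) ^+ (n - 2 * j)) *+ 'C(n - j, j).
pose h n : A := \sum_(i < n.+1) x ^+ (n - i) * y ^+ i.
rewrite -/(h n).
have hS k : h k.+1 = x * h k + y ^+ k.+1.
  rewrite /h big_ord_recr /= subnn mul1r mulr_sumr; congr (_ + _).
  by apply: eq_bigr => i _; rewrite mulrA -exprS subSn // -ltnS.
(* Pascal's rule, term by term: it gives the sums of [t] the recurrence S(k+2) = (x + y) S(k+1) - x
   y S(k), which [h] satisfies as well. For [k < i] the differences truncate to 0 and every binomial
   coefficient involved vanishes. *)
have tS k i : t k.+2 i.+1 = (x + y) * t k.+1 i.+1 - x * y * t k i.
  rewrite /t (subSS i k.+1) (subSS i k) [(- _) ^+ i.+1]exprS.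
  have [lt_ki|le_ik] := ltnP k i.
    have /eqP-> : (k.+1 - i)%N == 0 by rewrite subn_eq0.
    have /eqP-> : (k - i)%N == 0 by rewrite subn_eq0 ltnW.
    by case: i lt_ki => // i' _; rewrite !bin0n !mulr0n !mulr0 subr0.
  rewrite (subSn le_ik) binS.
  have [lt2|ge2] := ltnP (k - i) i.+1.
    rewrite (bin_small lt2) mulr0n !mulr0 !add0r.
    have -> : (k.+2 - 2 * i.+1 = k - 2 * i)%N by lia.
    by ring.
  have -> : (k.+2 - 2 * i.+1 = (k.+1 - 2 * i.+1).+1)%N by lia.
  have -> : (k - 2 * i = (k.+1 - 2 * i.+1).+1)%N by lia.
  by rewrite !exprS; ring.
have t0 k : t k 0%N = (x + y) ^+ k by rewrite /t muln0 subn0 bin0 mul1r.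
have base k l : (k <= 1)%N -> \sum_(j < l.+1) t k j = (x + y) ^+ k.
  move=> k1; rewrite big_ord_recl t0 big1 ?addr0 // => i _.
  by rewrite /t lift0 bin_small //; lia.
suff: forall m, (n./2 < m)%N -> \sum_(j < m) t n j = h n by apply.
elim/ltn_ind: n => -[|[|n]] IH [|{}m] // ltnm.
- by rewrite base // /h big_ord1 !expr0 mulr1.
- by rewrite base // hS /h big_ord1; ring.
rewrite big_ord_recl; under eq_bigr => i _ do rewrite lift0 tS.
rewrite sumrB -!mulr_sumr (IH n) //.
(* Bound [m.+1] in the induction hypothesis: removing its term j = 0 leaves exactly the [m] shifted
   terms. *)
have <- : h n.+1 - t n.+1 0%N = \sum_(i < m) t n.+1 i.+1.
  rewrite -(IH n.+1 (ltnSn _) m.+1); last by lia.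
  rewrite big_ord_recl; under eq_bigr => i _ do rewrite lift0.
  by rewrite addrC addKr.
by rewrite !hS !t0 !exprS; ring.
Qed.

(** With i = j + 1, this turns the coefficient n/(n-i) C(n-i,i) of [f_poly] into a sum of two
    binomial coefficients. It comes from n = (n - i) + i and the absorption identity. *)
Lemma mul_bin_lucas (n j : nat) : (2 * j.+1 <= n)%N ->
  (n * 'C(n - j.+1, j.+1) =
     (n - j.+1) * ('C(n - j.+1, j.+1) + 'C(n - j.+2, j)))%N.
Proof.
move=> le_jn.
have -> : (n - j.+2 = (n - j.+1).-1)%N by lia.
rewrite mulnDr mul_bin_diag -mulnDl; congr (_ * _)%N; lia.
Qed.

(** Over [C], all m < p roots of the minimal polynomial of [x] have p-th power [a], so their product
    [c], which lies in [K], satisfies c^p = a^m. As m is prime to p, Bezout's identity extracts a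
    p-th root of [a]. *)
Lemma prime_root_of_adjoin_degree (F0 : fieldType) (L : fieldExtType F0)
    (C : closedFieldType) (iota : {rmorphism L -> C}) (K : {subfield L})
    (p : nat) (a x : L) :
  prime p -> a \in K -> x ^+ p = a -> adjoin_degree K x != p ->
  exists2 b, b \in K & b ^+ p = a.
Proof.
move=> p_pr aK xp degx; have p_gt0 := prime_gt0 p_pr.
have [a0|a_neq0] := eqVneq a 0.
  by exists 0; [apply: mem0v | rewrite a0 expr0n gtn_eqF].
set m := adjoin_degree K x in degx.
have dvd : minPoly K x %| 'X^p - a%:P.
  apply: minPoly_dvdp; first by rewrite rpredB ?rpredX ?polyOverX ?polyOverC.
  by rewrite rootE !hornerE xp subrr.
have m_gt0 : (0 < m)%N by [].
have m_lt : (m < p)%N.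
  rewrite ltn_neqAle degx /= -ltnS -size_minPoly -(size_XnsubC a p_gt0).
  by rewrite dvdp_leq // -size_poly_gt0 size_XnsubC.
have [r Er] := closed_field_poly_normal (map_poly iota (minPoly K x)).
rewrite lead_coef_map (monicP (monic_minPoly K x)) rmorph1 scale1r in Er.
have size_r : size r = m.
  by have := size_prod_XsubC r id; rewrite -Er size_map_poly size_minPoly => -[].
have rP z : z \in r -> z ^+ p = iota a.
  move=> zr; have : root (map_poly iota ('X^p - a%:P)) z.
    have /dvdpP[q ->] := dvd.
    by rewrite rmorphM rootM /= Er root_prod_XsubC zr orbT.
  rewrite rmorphB /= map_polyXn map_polyC rootE !hornerE subr_eq0.
  by move/eqP.
pose c := (-1) ^+ m * (minPoly K x)`_0.
have cK : c \in K.
  by rewrite rpredM ?rpredX ?rpredN ?mem1v //; apply/polyOverP/minPolyOver.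
have cp : c ^+ p = a ^+ m.
  apply: (fmorph_inj iota); rewrite !rmorphXn rmorphM /= rmorphXn rmorphN1.
  rewrite -coef_map /= Er coef0_prod_XsubC size_r mulrA -exprD addnn -muln2.
  rewrite exprM sqrr_sign mul1r -prodrXl (eq_big_seq _ rP).
  by rewrite big_const_seq count_predT size_r iter_mulr_1.
have co : coprime m p by rewrite coprime_sym prime_coprime // gtnNdvd.
(* Here u m = v p + 1, so (c^u / a^v)^p = a^(u m - v p) = a. *)
case: (egcdnP p m_gt0) => u v Euv _; rewrite (eqP co) in Euv.
exists (c ^+ u / a ^+ v); first by rewrite rpredM ?rpredV ?rpredX.
rewrite expr_div_n exprAC cp -!exprM [(m * u)%N]mulnC Euv exprD expr1.
by rewrite mulrAC mulfV ?mul1r // expf_neq0.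
Qed.

(** [mul_bin_lucas] splits the sum into S(p) - x y S(p-2), with S the sums evaluated by
    [sum_bin_exprD]; in the difference every monomial divisible by x y cancels, leaving x^p +
    y^p. *)
Lemma f_poly_horner (F : fieldType) (iota : {rmorphism rat -> F}) (p : nat)
    (d R : rat) (x y : F) :
  odd p -> (1 < p)%N -> iota (d ^+ 2 - R) = x * y ->
  (map_poly iota (f_poly p d R)).[x + y]
    = x ^+ p + y ^+ p - 2 * iota d * (x * y) ^+ (p.-1)./2.
Proof.
case: p => [|[|n]] // /[!(oddS, negbK)] odd_n _ xyE.
rewrite /f_poly; set D := d ^+ 2 - R in xyE *.
rewrite rmorphB rmorph_sum /= hornerD horner_sum hornerN map_polyC hornerC /=.
rewrite !rmorphM rmorphXn rmorph_nat xyE; congr (_ - _).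
rewrite big_mkord addn1; set h := uphalf n.
under eq_bigr => j _.
  rewrite map_polyZ map_polyXn hornerZ hornerXn /=.
  over.
have coefE j : (j < h)%N ->
  iota ((-1) ^+ j.+1 * (n.+2%:R / (n.+2 - j.+1)%:R) * 'C(n.+2 - j.+1, j.+1)%:R
     * D ^+ j.+1) = (- (x * y)) ^+ j.+1 *+ ('C(n.+2 - j.+1, j.+1) + 'C(n - j, j)).
  move=> lt_jh; have le_jn : (2 * j.+1 <= n.+2)%N by lia.
  have nz : (n.+2 - j.+1)%:R != 0 :> rat by rewrite pnatr_eq0; lia.
  have qE : n.+2%:R / (n.+2 - j.+1)%:R * 'C(n.+2 - j.+1, j.+1)%:R
      = ('C(n.+2 - j.+1, j.+1) + 'C(n - j, j))%:R :> rat.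
    by rewrite mulrAC -natrM mul_bin_lucas // natrM mulrAC mulfV // mul1r.
  rewrite -[_ * _ * _%:R]mulrA qE !rmorphM !rmorphXn rmorphN1 rmorph_nat xyE.
  by rewrite mulrAC mulr_natr -[in RHS]mulN1r !exprMn.
rewrite big_ord_recl -[nat_of_ord ord0]/0%N muln0 !subn0 !expr0 bin0 mulr1.
rewrite mulr1 mul1r divff ?pnatr_eq0 // rmorph1 mul1r.
under eq_bigr => j _.
  rewrite lift0 coefE // mulrnDr mulrDl.
  over.
(* The second binomial coefficient occurs only for indices at least 1; shifting the index there
   brings out the factor - x y. *)
transitivity (\sum_(j < h.+1)
    ((- (x * y)) ^+ j * (x + y) ^+ (n.+2 - 2 * j)) *+ 'C(n.+2 - j, j)
  - x * y * \sum_(j < h)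
    ((- (x * y)) ^+ j * (x + y) ^+ (n - 2 * j)) *+ 'C(n - j, j)).
  rewrite big_split /= addrA; congr (_ + _).
    rewrite [RHS]big_ord_recl -[nat_of_ord ord0]/0%N muln0 !subn0 bin0 mul1r.
    by congr (_ + _); apply: eq_bigr => i _; rewrite lift0 mulrnAl.
  rewrite mulr_sumr -sumrN; apply: eq_bigr => i _.
  have -> : (n.+2 - 2 * i.+1 = n - 2 * i)%N by lia.
  by rewrite exprS; ring.
rewrite !sum_bin_exprD; [|rewrite /h; lia..].
rewrite big_ord_recl big_ord_recr mulr_sumr /= !subnn !subn0 !mulr1 mul1r.
rewrite [X in _ + (X + _) - _](_ : _ =
  \sum_(i < n.+1) x * y * (x ^+ (n - i) * y ^+ i)); first by ring.
apply: eq_bigr => i _; rewrite /bump /= add1n.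
have le_in : (i <= n)%N by rewrite -ltnS.
by rewrite subSS (subSn le_in) !exprS; ring.
Qed.

(** Replaces the automorphism s -> -s of Q(s): X^2 - R is irreducible over Q, hence divides every
    rational polynomial vanishing at [s], so a polynomial identity at [s] also holds at [-s]. *)
Lemma quadratic_conj_expr (L : fieldExtType rat) (R : rat) (s b : L) (p : nat)
    (T : {poly rat}) :
  ~ (exists x : rat, x ^+ 2 = R) -> s ^+ 2 = R%:A -> b \in <<1; s>>%VS ->
  b ^+ p = (map_poly (in_alg L) T).[s] ->
  exists u v : rat,
    (u%:A + v%:A * s) ^+ p = (map_poly (in_alg L) T).[s] /\
    (u%:A - v%:A * s) ^+ p = (map_poly (in_alg L) T).[- s].
Proof.
move=> nsqR sR /Fadjoin_polyP[_ /polyOver1P[P ->] bE] bp.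
pose q : {poly rat} := 'X^2 - R%:P.
have szq : size q = 3%N by rewrite size_XnsubC.
have q_irr : irreducible_poly q.
  apply: cubic_irreducible => [|x]; first by rewrite szq.
  by apply/negP; rewrite rootE !hornerE subr_eq0 => /eqP xR; case: nsqR; exists x.
have qE t : (map_poly (in_alg L) q).[t] = t ^+ 2 - R%:A.
  by rewrite rmorphB /= map_polyXn map_polyC !hornerE.
(* Reduction modulo [q] keeps the value at [s] and leaves a polynomial of degree at most 1, whose
   coefficients are [u] and [v]. *)
pose r := P %% q.
have szr : (size r <= 2)%N by rewrite -ltnS -szq ltn_modpN0 // -size_poly_gt0 szq.
have rE t : (map_poly (in_alg L) r).[t] = (r`_0)%:A + (r`_1)%:A * t.
  rewrite (horner_coef_wide (n := 2)) ?size_map_poly //.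
  by rewrite !big_ord_recl big_ord0 !coef_map /= expr0 expr1 mulr1 addr0.
have rs : (map_poly (in_alg L) r).[s] = b.
  rewrite bE [in RHS](divp_eq P q) rmorphD rmorphM /= hornerD hornerM qE sR.
  by rewrite subrr mulr0 add0r.
have q_dvd : q %| r ^+ p - T.
  rewrite -[_ %| _]negbK -irreducible_poly_coprime // -(coprimep_map (in_alg L)).
  apply/negP => /coprimep_root qT; have /qT/eqP[] : root (map_poly (in_alg L) q) s.
    by rewrite rootE qE sR subrr.
  by rewrite rmorphB rmorphXn /= !hornerE /= rs bp subrr.
exists r`_0, r`_1; rewrite -mulrN -!rE rs bp; split=> //.
have /dvdpP[k] := q_dvd.
move=> /(congr1 (fun g => (map_poly (in_alg L) g).[- s])).
rewrite rmorphM rmorphB rmorphXn /= hornerM qE sqrrN sR subrr mulr0.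
by rewrite !hornerE /= => /eqP; rewrite subr_eq0 => /eqP.
Qed.

Lemma exprn_odd_inj (A : realFieldType) (n : nat) :
  odd n -> injective (fun x : A => x ^+ n).
Proof.
move=> odd_n x y /= Exy; have n_gt0 := odd_gt0 odd_n.
have [x_ge0|x_lt0] := lerP 0 x.
  have y_ge0 : 0 <= y by rewrite -(exprn_odd_ge0 _ odd_n) -Exy exprn_ge0.
  by apply/eqP; rewrite -(eqrXn2 n_gt0) ?Exy.
have y_lt0 : y < 0 by rewrite -(exprn_odd_lt0 _ odd_n) -Exy exprn_odd_lt0.
apply/oppr_inj/eqP; rewrite -(eqrXn2 n_gt0) ?oppr_ge0 ?ltW //.
by rewrite (exprNn x) (exprNn y) Exy.
Qed.

Lemma size_f_poly (p : nat) (d R : rat) :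
  odd p -> (1 < p)%N -> size (f_poly p d R) = p.+1.
Proof.
case: p => [|[|[|n]]] // _ _; rewrite /f_poly addn1 big_mkord big_ord_recl.
rewrite -[nat_of_ord ord0]/0%N muln0 !subn0 bin0 !expr0 !mulr1 mul1r.
rewrite divff ?pnatr_eq0 // scale1r -addrA size_polyDl size_polyXn //.
rewrite ltnS (leq_trans (size_polyD _ _)) // geq_max size_polyN.
rewrite (leq_trans (size_polyC_leq1 _)) // andbT.
apply: (leq_trans (size_sum _ _ _)); apply/bigmax_leqP => j _.
by rewrite (leq_trans (size_scale_leq _ _)) // size_polyXn lift0; lia.
Qed.

Theorem theorem4 (p : nat) (d R : rat) :
  prime p -> (3 <= p)%N -> d != 0 -> ~ (exists x : rat, x ^+ 2 = R) ->
  (forall z : rat, ~~ root (f_poly p d R) z) ->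
  irreducible_poly (f_poly p d R).
Proof.
move=> p_pr p_ge3 _ nsqR noroot.
have p_odd : odd p by case: (even_prime p_pr) p_ge3 => [->|].
have p_gt0 := prime_gt0 p_pr; have p_gt1 := prime_gt1 p_pr.
pose D := d ^+ 2 - R; pose h := (p.-1)./2.
have pE : p = (h + h).+1 by rewrite /h; lia.
have D_neq0 : D != 0.
  by apply/eqP => /subr0_eq dR; apply: nsqR; exists d.
pose sC : algC := sqrtC (ratr R).
pose aC : algC := ratr (D ^+ h) * (ratr d + sC).
have [L [iota [[|s [|al [|]]] //= [sE alE] _]]] :=
  num_field_exists [:: sC; p.-root aC].
have iotaA x : iota x%:A = ratr x by rewrite alg_num_field fmorph_rat.
have sR : s ^+ 2 = R%:A.
  by apply: (fmorph_inj iota); rewrite rmorphXn /= sE sqrtCK iotaA.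
(* [T] takes the values [a] at [s] and [a'] at [-s], the form needed for conjugation. *)
pose T : {poly rat} := (D ^+ h)%:P * (d%:P + 'X).
have TE t : (map_poly (in_alg L) T).[t] = (D ^+ h)%:A * (d%:A + t).
  by rewrite rmorphM rmorphD /= map_polyX !map_polyC !hornerE.
pose a := (D ^+ h)%:A * (d%:A + s) : L.
pose a' := (D ^+ h)%:A * (d%:A - s) : L.
have alp : al ^+ p = a.
  apply: (fmorph_inj iota); rewrite rmorphXn /= alE rootCK //.
  by rewrite rmorphM rmorphD /= !iotaA sE.
have DA : D%:A = d%:A ^+ 2 - s ^+ 2 :> L.
  by rewrite sR -!in_algE rmorphB rmorphXn.
have aa' : a * a' = D%:A ^+ p.
  rewrite pE exprS exprD {1}DA /a /a' -!in_algE rmorphXn; ring.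
have DA_neq0 : D%:A != 0 :> L by rewrite -in_algE fmorph_eq0.
have a_neq0 : a != 0.
  by apply: contraTneq (expf_neq0 p DA_neq0); rewrite -aa' => ->; rewrite mul0r eqxx.
have al_neq0 : al != 0.
  by apply: contraNneq a_neq0 => al0; rewrite -alp al0 expr0n gtn_eqF.
pose f := f_poly p d R; pose z := al + D%:A / al.
(* Serves twice: for the pair [al], D / [al], whose sum is [z], and for a conjugate pair in [K],
   whose sum is rational. *)
have fE (x y : L) : x * y = D%:A -> x ^+ p + y ^+ p = a + a' ->
    root (map_poly (in_alg L) f) (x + y).
  move=> xy xyp; rewrite rootE.
  rewrite (f_poly_horner (iota := in_alg L) p_odd p_gt1 (esym xy)) xy xyp.
  by rewrite -/h /a /a' -!in_algE rmorphXn; apply/eqP; ring.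
have fz : root (map_poly (in_alg L) f) z.
  apply: fE; first by rewrite mulrCA divff // mulr1.
  by rewrite expr_div_n alp -aa' mulrAC divff // mul1r.
pose K := <<1; s>>%AS.
have dA (U : {subfield L}) (x : rat) : x%:A \in U by rewrite rpredZ ?mem1v.
have aK : a \in K by rewrite rpredM ?rpredD ?dA ?memv_adjoin.
have degal : adjoin_degree K al = p.
  apply/eqP; apply: contraT => degal.
  have [b bK bp] := prime_root_of_adjoin_degree iota p_pr aK alp degal.
  have [|u [v []]] := quadratic_conj_expr (T := T) (p := p) nsqR sR bK.
    by rewrite bp TE.
  rewrite !TE -/a -/a' => uvp uvp'.
  have nD : u ^+ 2 - v ^+ 2 * R = D.
    apply: (exprn_odd_inj p_odd); apply: (fmorph_inj (in_alg L)) => /=.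
    rewrite -!in_algE !rmorphXn /= -aa' -uvp -uvp' -exprMn; congr (_ ^+ _).
    by rewrite -!in_algE rmorphB rmorphXn rmorphM rmorphXn /= -sR; ring.
  suff: root (map_poly (in_alg L) f) (in_alg L (u + u)).
    by rewrite fmorph_root (negPf (noroot _)).
  have -> : in_alg L (u + u) = (u%:A + v%:A * s) + (u%:A - v%:A * s).
    by rewrite rmorphD /=; ring.
  apply: fE; last by rewrite uvp uvp'.
  by rewrite -nD -!in_algE rmorphB rmorphXn rmorphM rmorphXn /= -sR; ring.
have deg_le (U : {subfield L}) x (g : {poly L}) : g \is a polyOver U ->
    root g x -> g != 0 -> (adjoin_degree U x < size g)%N.
  by move=> gU gx g0; rewrite -size_minPoly dvdp_leq // minPoly_dvdp.
pose M := <<1; z>>%AS.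
have p_dvd : (p %| \dim M)%N.
  (* [E2] contains K(al), so p divides its dimension; neither step of the tower from [M] to [E2] can
     contribute the factor p, since both have degree 1 or 2 and p >= 3. *)
  pose E1 := <<M; al>>%AS; pose E2 := <<E1; s>>%AS.
  have sub : (<<K; al>> <= E2)%VS.
    apply/FadjoinP; split; last by rewrite (subvP (subv_adjoin _ _)) ?memv_adjoin.
    by apply/FadjoinP; rewrite sub1v memv_adjoin.
  have := field_dimS sub; rewrite !dim_Fadjoin degal.
  move=> /(dvdn_trans (dvdn_mulr _ (dvdnn p))).
  have small k : (0 < k < 3)%N -> (p %| k)%N = false.
    by case/andP=> k_gt0 k3; rewrite gtnNdvd // (leq_trans k3).
  have deg_s : (adjoin_degree E1 s < 3)%N.
    rewrite -(@size_XnsubC L 2 R%:A) // deg_le //.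
    - by rewrite rpredB ?rpredX ?polyOverX ?polyOverC ?dA.
    - by rewrite rootE !hornerE sR subrr.
    - by rewrite -size_poly_gt0 size_XnsubC.
  have deg_al : (adjoin_degree M al < 3)%N.
    (* X^2 - z X + D, with roots [al] and D / [al]. *)
    pose g : {poly L} := 'X^2 - (z *: 'X - D%:A%:P).
    have szg : size g = 3%N.
      rewrite size_polyDl size_polyXn // size_polyN.
      rewrite ltnS (leq_trans (size_polyD _ _)) // geq_max size_polyN.
      rewrite (leq_trans (size_scale_leq _ _)) ?size_polyX //.
      by rewrite leqW // size_polyC_leq1.
    rewrite -szg deg_le -?size_poly_gt0 ?szg //.
      rewrite !rpredB ?rpredX ?polyOverX ?polyOverC ?dA //.
      by rewrite polyOverZ ?memv_adjoin ?polyOverX.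
    rewrite rootE !hornerE /z mulrDl divfK //; apply/eqP; ring.
  by rewrite Euclid_dvdM // small ?deg_s // Euclid_dvdM // small ?deg_al.
have size_ge (g : {poly rat}) :
    g != 0 -> root (map_poly (in_alg L) g) z -> (p < size g)%N.
  move=> g0 gz; have := dvdn_leq (adim_gt0 _) p_dvd.
  rewrite dim_Fadjoin dimv1 muln1 => /leq_ltn_trans; apply.
  rewrite -(size_map_poly (in_alg L)) deg_le ?map_poly_eq0 //.
  by apply/polyOver1P; exists g.
have szf : size f = p.+1 := size_f_poly d R p_odd p_gt1.
have f_neq0 : f != 0 by rewrite -size_poly_gt0 szf.
split=> [|g szg /dvdpP[k fk]]; first by rewrite szf ltnS.
have [k_neq0 g_neq0] : k != 0 /\ g != 0.
  by apply/andP; rewrite -negb_or -mulf_eq0 -fk.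
have szfk : (size k + size g)%N = p.+2.
  by rewrite -szf /f fk size_mul // prednK // addn_gt0 size_poly_gt0 k_neq0.
(* The factor vanishing at [z] has size at least p + 1 and the two sizes add up to p + 2, so the
   other factor is a nonzero constant. This contradicts [szg] if that constant is [g], and makes [g]
   an associate of [f] if it is [k]. *)
move: fz; rewrite /f fk rmorphM rootM => /orP[/(size_ge _ k_neq0)|/(size_ge _ g_neq0)] pk.
  have := g_neq0; rewrite -size_poly_gt0 => g_gt0; case/negP: szg.
  by rewrite eqn_leq g_gt0 andbT -(leq_add2l (size k)) szfk addn1.
have := k_neq0; rewrite -size_poly_gt0 => k_gt0.
rewrite -dvdp_size_eqp ?dvdp_mull // -fk szf eqn_leq pk andbT.
by rewrite -ltnS -szfk -add1n leq_add2r.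
Qed.
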